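(* Let $R$ be a ring and let $\sigma$ be a radical on $R\text{-Mod}$. If $\overline{\mathbb{P}}_\sigma=\mathbb{S}_\sigma$, then $\sigma$ is a $t$-radical.
   Context: $R$ is an associative ring with identity; modules are left $R$-modules. A preradical on $R\text{-Mod}$ is a functor $\sigma:R\text{-Mod}\to R\text{-Mod}$ with $\sigma(M)\le M$ for all $M$ and $f(\sigma(M))\le\sigma(N)$ for every homomorphism $f:M\to N$ ($\sigma(f)$ being the restriction of $f$). A preradical $\sigma$ is a radical if $\sigma(M/\sigma(M))=0$ for every $M$, and a $t$-radical if $\sigma(M)=\sigma(R)M$ for every $M$. $\mathbb{T}_\sigma=\{M\mid\sigma(M)=M\}$. $\overline{\mathbb{P}}_\sigma$ is the class consisting of the zero module and all nonzero modules $M$ that are $\sigma$-co-first, i.e. either $M\in\mathbb{T}_\sigma$ or $M$ has no nonzero quotient in $\mathbb{T}_\sigma$. $\mathbb{S}_\sigma$ is the class consisting of the zero module and all nonzero modules $M$ that are $\sigma$-second, i.e. $\sigma(M)=0$ or $\sigma(M)=M$. *)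

(* Defs.v *)
From HB Require Import structures.
From mathcomp Require Import all_boot all_algebra.

Set Implicit Arguments.
Unset Strict Implicit.
Unset Printing Implicit Defensive.

Import GRing.Theory.

Local Open Scope ring_scope.
Local Open Scope quotient_scope.

(* Rings are [pzRingType]: associative, unital, not necessarily commutative,   *)
(* the zero ring being allowed. [lmodType R] is the type of left R-modules and *)
(* [submodClosed M] the type of submodules of M, as boolean predicates (under  *)
(* classical logic, with informative excluded middle, these are all of them).  *)

Section QuotientModule.

Variables (R : pzRingType) (M : lmodType R) (N : submodClosed M).

(* Mathcomp's quotient {quot _} of additive groups requires a [zmodClosed]     *)
(* predicate, which [submodClosed] does not inherit from.                      *)
Definition submod_mem : {pred M} := fun x => x \in N.

Fact submod_mem_zmod : zmod_closed submod_mem.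
Proof.
split=> [|x y Nx Ny]; first exact: (rpred0 N).
by apply: (rpredD (Nx : x \in N)); rewrite -scaleN1r rpredZ.
Qed.

HB.instance Definition _ := GRing.isZmodClosed.Build M submod_mem submod_mem_zmod.

Definition quotmod : Type := Quotient.quot submod_mem.

HB.instance Definition _ := GRing.Zmodule.on quotmod.
HB.instance Definition _ := EqQuotient.on quotmod.

Fact pi_quotmodD : {morph \pi_quotmod : x y / x + y}.
Proof. exact: Quotient.pi_add. Qed.

Definition quotmod_scale (a : R) := lift_op1 quotmod (fun x : M => a *: x).

Fact pi_quotmod_scale a :
  {morph \pi_quotmod : x / a *: x >-> quotmod_scale a x}.
Proof.
move=> x; unlock quotmod_scale; apply/eqP.
rewrite -Quotient.idealrBE -scalerBr; apply: (@rpredZ _ _ N).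
by change (x - repr (\pi_quotmod x) \in submod_mem); rewrite Quotient.idealrBE reprK.
Qed.

Fact quotmod_scaleA a b v :
  quotmod_scale a (quotmod_scale b v) = quotmod_scale (a * b) v.
Proof. by rewrite -[v]reprK -!pi_quotmod_scale scalerA. Qed.

Fact quotmod_scale1 : left_id 1 quotmod_scale.
Proof. by move=> v; rewrite -[v]reprK -pi_quotmod_scale scale1r. Qed.

Fact quotmod_scaleDr : right_distributive quotmod_scale +%R.
Proof.
move=> a u v; rewrite -[u]reprK -[v]reprK -pi_quotmodD.
by rewrite -!pi_quotmod_scale -pi_quotmodD scalerDr.
Qed.

Fact quotmod_scaleDl v : {morph quotmod_scale^~ v : a b / a + b}.
Proof.
move=> a b; rewrite -[v]reprK -!pi_quotmod_scale -pi_quotmodD.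
by rewrite scalerDl.
Qed.

HB.instance Definition _ := GRing.Zmodule_isLmodule.Build R quotmod
  quotmod_scaleA quotmod_scale1 quotmod_scaleDr quotmod_scaleDl.

Fact pi_quotmod_linear : linear (\pi_quotmod : M -> quotmod).
Proof. by move=> a x y; rewrite pi_quotmodD pi_quotmod_scale. Qed.

Fact pi_quotmod_eq0 (x : M) : (\pi_quotmod x == 0) = (x \in N).
Proof.
have -> : (0 : quotmod) = \pi_quotmod 0.
  by apply: (addIr (\pi_quotmod 0)); rewrite add0r -pi_quotmodD addr0.
by rewrite -Quotient.idealrBE subr0.
Qed.

End QuotientModule.

Definition is_zero_module (R : pzRingType) (M : lmodType R) : Prop :=
  forall x : M, x = 0.

(* The action on morphisms is restriction, so a preradical is determined by    *)
(* its action on objects; functoriality is then automatic.                     *)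
Record preradical (R : pzRingType) := Preradical {
  prerad :> forall M : lmodType R, submodClosed M;
  prerad_hom : forall (M N : lmodType R) (f : {linear M -> N}) (x : M),
    x \in prerad M -> f x \in prerad N
}.

Section Preradicals.

Variables (R : pzRingType) (sigma : preradical R).

Definition prerad_zero (M : lmodType R) : Prop :=
  forall x : M, x \in sigma M -> x = 0.

Definition torsion (M : lmodType R) : Prop := forall x : M, x \in sigma M.

Definition is_radical : Prop :=
  forall M : lmodType R, prerad_zero (quotmod (sigma M)).

(* I M : the finite sums of products a m with a in I and m in M. *)
Definition ideal_mul (I : {pred R^o}) (M : lmodType R) (x : M) : Prop :=
  exists (n : nat) (a : 'I_n -> R^o) (m : 'I_n -> M),
    (forall i, a i \in I) /\ x = \sum_(i < n) (a i : R) *: m i.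

Definition is_t_radical : Prop :=
  forall (M : lmodType R) (x : M),
    x \in sigma M <-> ideal_mul (sigma R^o) x.

Definition cofirst (M : lmodType R) : Prop :=
  torsion M \/
  forall N : submodClosed M,
    ~ is_zero_module (quotmod N) -> ~ torsion (quotmod N).

Definition second (M : lmodType R) : Prop := prerad_zero M \/ torsion M.

Definition cofirst_class (M : lmodType R) : Prop :=
  is_zero_module M \/ (~ is_zero_module M /\ cofirst M).

Definition second_class (M : lmodType R) : Prop :=
  is_zero_module M \/ (~ is_zero_module M /\ second M).

End Preradicals.

(* Main.v *)
Require Import Defs.
From HB Require Import structures.
From mathcomp Require Import all_boot all_algebra.
From mathcomp Require Import boolp classical_sets functions fsbigop.
From mathcomp Require Import finmap.

(** Write I for the left ideal sigma(R), and call M torsion-free when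
    sigma(M) = 0.  The hypothesis on classes makes torsion-freeness pass to
    quotients: a nonzero torsion-free module is sigma-second, hence
    sigma-co-first, hence has no nonzero torsion quotient
    ([torsionfree_no_torsion_image]).  A quotient of it has none either, so it
    is sigma-co-first, hence sigma-second, and being non-torsion it is
    torsion-free ([torsionfree_image]).

    Now let M be any module and F = R^(M) the free module on the set M.  The
    coordinate maps F -> R send sigma(F) into I, so the canonical surjection
    F -> M sends sigma(F) into IM ([free_eval_prerad]).  It therefore induces a
    surjection F/sigma(F) -> M/IM, whose source is torsion-free because sigma is
    a radical.  Hence M/IM is torsion-free, that is sigma(M) <= IM.  The other
    inclusion holds for every preradical: for m in M the map r |-> r m sends I
    into sigma(M). *)

Set Implicit Arguments.
Unset Strict Implicit.
Unset Printing Implicit Defensive.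

Import GRing.Theory.

Local Open Scope ring_scope.
Local Open Scope quotient_scope.

(** * Linear maps and quotient modules *)

Section LinearMaps.

Variable R : pzRingType.

(** The projection needs a name of its own to carry a linear structure. *)
Definition quot_proj (M : lmodType R) (N : submodClosed M) (x : M) :
  quotmod N := \pi_(quotmod N) x.

HB.instance Definition _ (M : lmodType R) (N : submodClosed M) :=
  GRing.isLinear.Build R M (quotmod N) *:%R (@quot_proj M N)
    (@pi_quotmod_linear R M N).

Lemma quot_proj_eq0 (M : lmodType R) (N : submodClosed M) (x : M) :
  (quot_proj N x == 0) = (x \in N).
Proof. exact: pi_quotmod_eq0. Qed.

Lemma quot_proj_surj (M : lmodType R) (N : submodClosed M) (y : quotmod N) :
  exists x, quot_proj N x = y.
Proof. by exists (repr y); rewrite /quot_proj reprK. Qed.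

Definition ker_mem (M N : lmodType R) (f : {linear M -> N}) : {pred M} :=
  fun x => f x == 0.

Fact ker_mem_submod (M N : lmodType R) (f : {linear M -> N}) :
  subsemimod_closed (ker_mem f).
Proof.
split; [split|] => [|x y|a x]; rewrite !unfold_in ?linear0 //.
  by move=> /eqP fx0 /eqP fy0; rewrite linearD fx0 fy0 addr0.
by move=> /eqP fx0; rewrite linearZ /= fx0 scaler0.
Qed.

HB.instance Definition _ (M N : lmodType R) (f : {linear M -> N}) :=
  GRing.isSubmodClosed.Build R M (ker_mem f) (ker_mem_submod f).

(** The universal property of a surjection, so that images of a module need
    not be identified with its quotients. *)
Lemma linear_factor (A B C : lmodType R) (f : {linear A -> B})
    (h : {linear A -> C}) :
  (forall b, exists a, f a = b) -> (forall a, f a = 0 -> h a = 0) ->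
  exists k : {linear B -> C}, forall a, k (f a) = h a.
Proof.
move=> fsurj fh.
have fsurjb b : exists a, f a == b by have [a <-] := fsurj b; exists a.
pose s b := xchoose (fsurjb b).
have fs b : f (s b) = b by apply/eqP; exact: (xchooseP (fsurjb b)).
have hf a a' : f a = f a' -> h a = h a'.
  move=> faa'; apply/eqP; rewrite -subr_eq0 -linearB; apply/eqP/fh.
  by rewrite linearB faa' subrr.
have klin : linear (h \o s).
  by move=> a x y /=; rewrite -linearP; apply: hf; rewrite linearP !fs.
pose kL := GRing.isLinear.Build R B C *:%R (h \o s) klin.
pose k : {linear B -> C} := HB.pack (h \o s) kL.
by exists k => a; apply: hf; rewrite fs.
Qed.

End LinearMaps.

(** * Torsion-free modules are closed under images *)

Section Images.

Variables (R : pzRingType) (sigma : preradical R).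

Hypothesis classes_eq : forall M : lmodType R,
  cofirst_class sigma M <-> second_class sigma M.

Lemma torsionfree_no_torsion_image (A C : lmodType R) (f : {linear A -> C}) :
  (forall c, exists a, f a = c) -> prerad_zero sigma A -> torsion sigma C ->
  is_zero_module C.
Proof.
move=> fsurj A0 Ctors c; apply: contrapT => cn0.
have An0 : ~ is_zero_module A.
  by move=> A00; have [a fa] := fsurj c; apply: cn0; rewrite -fa (A00 a) linear0.
have /classes_eq[//|[_ cofA]] : second_class sigma A by right; split; last left.
case: cofA => [Ators|]; first by apply: An0 => a; exact: A0.
pose K : submodClosed A := ker_mem f.
move=> /(_ K); apply.
- move=> Q0; have [a fa] := fsurj c; apply: cn0; rewrite -fa; apply/eqP.
  change (a \in K); rewrite -quot_proj_eq0; apply/eqP; exact: Q0.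
- (* C is isomorphic to A / ker f, and sigma transfers along C -> A / ker f *)
  have [|g gf] := linear_factor (h := quot_proj K) fsurj.
    by move=> a /eqP fa0; apply/eqP; rewrite quot_proj_eq0.
  move=> y; have [a <-] := quot_proj_surj y; rewrite -gf.
  exact/prerad_hom/Ctors.
Qed.

Lemma torsionfree_image (A B : lmodType R) (f : {linear A -> B}) :
  (forall b, exists a, f a = b) -> prerad_zero sigma A -> prerad_zero sigma B.
Proof.
move=> fsurj A0 x xB; apply: contrapT => xn0.
have Bn0 : ~ is_zero_module B by move=> B0; apply: xn0.
have /classes_eq[//|[_ [B0|Btors]]] : cofirst_class sigma B.
- right; split=> //; right=> N Qn0 Qtors; apply: Qn0.
  apply: (@torsionfree_no_torsion_image A _ (quot_proj N \o f)) => // y.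
  have [b <-] := quot_proj_surj y; have [a <-] := fsurj b.
  by exists a.
- exact: xn0 (B0 _ xB).
- exact: xn0 (torsionfree_no_torsion_image fsurj A0 Btors x).
Qed.

End Images.

(** * The product of a left ideal and a module *)

Section IdealMul.

Variables (R : pzRingType) (I : submodClosed R^o) (M : lmodType R).

Definition ideal_mul_mem : {pred M} := fun x => `[< ideal_mul I x >].

Lemma ideal_mul_memP (x : M) : reflect (ideal_mul I x) (x \in ideal_mul_mem).
Proof. exact: asboolP. Qed.

Fact ideal_mul_submod : subsemimod_closed ideal_mul_mem.
Proof.
split; [split|] => [|x y /ideal_mul_memP[n [a [m [aI ->]]]]
  /ideal_mul_memP[p [b [q [bI ->]]]]|c x /ideal_mul_memP[n [a [m [aI ->]]]]].
- apply/ideal_mul_memP; exists 0%N, (fun=> 0), (fun=> 0).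
  by rewrite big_ord0; split=> // -[].
- apply/ideal_mul_memP; exists (n + p)%N.
  exists (fun i => match fintype.split i with inl j => a j | inr k => b k end).
  exists (fun i => match fintype.split i with inl j => m j | inr k => q k end).
  split=> [i|]; first by case: (fintype.split i).
  rewrite big_split_ord /=; congr (_ + _); apply: eq_bigr => i _.
    by rewrite -/(unsplit (inl i)) unsplitK.
  by rewrite -/(unsplit (inr i)) unsplitK.
- apply/ideal_mul_memP; exists n, (fun i => c *: a i), m.
  split=> [i|]; first exact: rpredZ.
  by rewrite scaler_sumr; apply: eq_bigr => i _; rewrite scalerA.
Qed.

HB.instance Definition _ :=
  GRing.isSubmodClosed.Build R M ideal_mul_mem ideal_mul_submod.

Lemma ideal_mul_scale (a : R^o) (m : M) :
  a \in I -> (a : R) *: m \in ideal_mul_mem.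
Proof.
move=> aI; apply/ideal_mul_memP; exists 1%N, (fun=> a), (fun=> m).
by rewrite big_ord1.
Qed.

End IdealMul.

(** * Free modules *)

Section FreeModule.

Variables (R : pzRingType) (X : choiceType).

Definition finsupp_mem : {pred X -> R^o} :=
  fun f => `[< exists A : {fset X}, forall x, x \notin A -> f x = 0 >].

Lemma finsupp_memP (f : X -> R^o) :
  reflect (exists A : {fset X}, forall x, x \notin A -> f x = 0)
          (f \in finsupp_mem).
Proof. exact: asboolP. Qed.

Fact finsupp_submod : subsemimod_closed finsupp_mem.
Proof.
split; [split|] => [|f g /finsupp_memP[A fA] /finsupp_memP[B gB]
  |a f /finsupp_memP[A fA]]; apply/finsupp_memP.
- by exists fset0.
- exists (A `|` B)%fset => x; rewrite in_fsetU negb_or => /andP[xA xB].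
  by rewrite addrfctE fA // gB // addr0.
- by exists A => x xA; rewrite scalrfctE fA // scaler0.
Qed.

HB.instance Definition _ :=
  GRing.isSubmodClosed.Build R (X -> R^o) finsupp_mem finsupp_submod.

(** The free module R^(X), as the submodule of finitely supported functions in
    the product R^X; its coordinates are thus restricted projections. *)
Record free_module := FreeModule {
  free_fun : X -> R^o;
  free_funP : free_fun \in finsupp_mem
}.

HB.instance Definition _ := [isSub for free_fun].
HB.instance Definition _ := [Choice of free_module by <:].
HB.instance Definition _ := [SubChoice_isSubLmodule of free_module by <:].

Definition free_coord (x : X) (f : free_module) : R^o := free_fun f x.

Fact free_coord_linear x : linear (free_coord x).
Proof.
move=> a f g; rewrite /free_coord.
by have -> : free_fun (a *: f + g) = a *: free_fun f + free_fun g
  by exact: (linearP (val : free_module -> _)).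
Qed.

HB.instance Definition _ x :=
  GRing.isLinear.Build R free_module R^o *:%R (free_coord x)
    (free_coord_linear x).

Lemma free_supp (f : free_module) :
  exists A : {fset X}, forall x, x \notin A -> free_coord x f = 0.
Proof. exact/finsupp_memP/free_funP. Qed.

Fact free_gen_subproof (x : X) :
  (fun y => (y == x)%:R : R^o) \in finsupp_mem.
Proof.
apply/finsupp_memP; exists [fset x]%fset => y.
by rewrite in_fset1 => /negbTE ->.
Qed.

Definition free_gen (x : X) := FreeModule (free_gen_subproof x).

Variables (M : lmodType R) (v : X -> M).

(** The linear map from R^(X) to M that extends v. *)
Definition free_eval (f : free_module) : M :=
  (\sum_(x \in [set: X]) (free_coord x f : R) *: v x)%R.

Lemma free_evalE (A : {fset X}) (f : free_module) :
  (forall x, x \notin A -> free_coord x f = 0) ->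
  free_eval f = \sum_(x <- A) (free_coord x f : R) *: v x.
Proof.
by move=> fA; apply: fsbigTE => x xA; rewrite fA // scale0r.
Qed.

Fact free_eval_linear : linear free_eval.
Proof.
move=> a f g; have [A fA] := free_supp f; have [B gB] := free_supp g.
have fC x : x \notin (A `|` B)%fset -> free_coord x f = 0.
  by rewrite in_fsetU negb_or => /andP[/fA].
have gC x : x \notin (A `|` B)%fset -> free_coord x g = 0.
  by rewrite in_fsetU negb_or => /andP[_ /gB].
rewrite (free_evalE fC) (free_evalE gC) (@free_evalE (A `|` B)%fset); last first.
  by move=> x xC; rewrite free_coord_linear fC // gC // scaler0 addr0.
under eq_bigr do rewrite free_coord_linear scalerDl -scalerA.
by rewrite big_split scaler_sumr.
Qed.

HB.instance Definition _ :=
  GRing.isLinear.Build R free_module M *:%R free_eval free_eval_linear.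

Lemma free_eval_gen (x : X) : free_eval (free_gen x) = v x.
Proof.
rewrite (@free_evalE [fset x]%fset) => [|y].
  by rewrite big_seq_fset1 /free_coord /= eqxx scale1r.
by rewrite in_fset1 /free_coord /= => /negbTE ->.
Qed.

(** Each coordinate is a linear map to R, hence sends sigma(R^(X)) into
    sigma(R). *)
Lemma free_eval_prerad (sigma : preradical R) (f : free_module) :
  f \in sigma free_module ->
  free_eval f \in @ideal_mul_mem R (sigma R^o) M.
Proof.
move=> fs; have [A fA] := free_supp f; rewrite (free_evalE fA).
by apply: rpred_sum => x _; apply/ideal_mul_scale/(prerad_hom (free_coord x)).
Qed.

End FreeModule.

(** * Preradicals and the ideal sigma(R) *)

Lemma ideal_mul_sub_prerad (R : pzRingType) (sigma : preradical R)
    (M : lmodType R) (x : M) :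
  ideal_mul (sigma R^o) x -> x \in sigma M.
Proof.
case=> n [a [m [aI ->]]]; apply: rpred_sum => i _.
have scale_lin : linear (fun r : R^o => (r : R) *: m i).
  by move=> c r s; rewrite scalerDl scalerA.
pose scaleL := GRing.isLinear.Build R R^o M *:%R _ scale_lin.
pose scale : {linear R^o -> M} := HB.pack (fun r : R^o => (r : R) *: m i) scaleL.
exact: (prerad_hom scale).
Qed.

Theorem proposition5p6 (R : pzRingType) (sigma : preradical R)
  (sigma_radical : is_radical sigma)
  (classes_eq : forall M : lmodType R,
     cofirst_class sigma M <-> second_class sigma M) :
  is_t_radical sigma.
Proof.
move=> M x; split; last exact: ideal_mul_sub_prerad.
move=> xs; apply/ideal_mul_memP.
pose IM : submodClosed M := @ideal_mul_mem R (sigma R^o) M.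
pose F : lmodType R := free_module R M.
pose ev : {linear F -> M} := free_eval (@id M).
have [||k kE] := linear_factor (f := quot_proj (sigma F))
  (h := quot_proj IM \o ev).
- exact: quot_proj_surj.
- move=> f /eqP; rewrite quot_proj_eq0 => fs; apply/eqP.
  by rewrite /= quot_proj_eq0; exact: free_eval_prerad.
have IM0 : prerad_zero sigma (quotmod IM).
  apply: (torsionfree_image classes_eq (f := k)) (sigma_radical F) => y.
  have [m <-] := quot_proj_surj y.
  exists (quot_proj (sigma F) (free_gen R m)).
  by rewrite kE /= free_eval_gen.
change (x \in IM); rewrite -quot_proj_eq0; apply/eqP/IM0.
exact: prerad_hom.
Qed.
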